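(* Let $T$ be a linear transformation on an $n$-dimensional Hilbert space with distinct eigenvalues $z_1,\dots,z_n\in\Omega$, and suppose the homomorphism $\rho_T:\mathcal{A}(\Omega)\to\mathcal{M}_n$ is contractive (equivalently, the linear map $L_T:(\mathbb{C}^n,\|\cdot\|_{\underline z})\to\mathcal{M}_n$, $L_T(\underline w)=w_1V_1+w_2V_2+\cdots+w_nV_n$, is contractive). Then $\rho_T$ is completely contractive with respect to the MIN operator space structure on $\mathcal{A}(\Omega)$ if and only if $L_T$ is completely contractive on the operator space $\mathrm{HC}_{\Omega,\underline z}(\mathbb{C}^n)$.
   Context: $\Omega\subseteq\mathbb{C}$ is a finitely connected bounded domain whose boundary is the disjoint union of simple analytic closed curves. $\mathcal{A}(\Omega)$ is the closure, in the supremum norm on $\Omega$, of the algebra of rational functions with poles off $\overline{\Omega}$. $\rho_T(f)=f(T)$ by the functional calculus; operators on the $n$-dimensional space are identified with $\mathcal{M}_n$ via an orthonormal basis, and $\mathcal{M}_n\otimes\mathcal{M}_k$ carries the operator norm on $\mathbb{C}^n\otimes\mathbb{C}^k$. The MIN structure on $\mathcal{A}(\Omega)$ is the one inherited from the commutative $C^*$-algebra $C(\partial\Omega)$: for $R\in\mathcal{A}(\Omega)\otimes\mathcal{M}_k$ (a matrix-valued function), $\|R\|=\sup_{z\in\overline\Omega}\|R(z)\|$. For each $k$ let $I^k_{\underline z}=\{(R(z_1),\dots,R(z_n)):R\in\mathcal{A}(\Omega)\otimes\mathcal{M}_k,\ \|R\|\le1\}\subseteq\mathbb{C}^n\otimes\mathcal{M}_k$.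 The norm $\|\cdot\|_{\underline z,k}$ on $\mathbb{C}^n\otimes\mathcal{M}_k$ is the one whose closed unit ball is $I^k_{\underline z}$; $\|\cdot\|_{\underline z}:=\|\cdot\|_{\underline z,1}$. $\mathrm{HC}_{\Omega,\underline z}(\mathbb{C}^n)$ denotes $\mathbb{C}^n$ with the operator space structure given by the norms $\|\cdot\|_{\underline z,k}$, $k\ge1$. The matrices $V_i\in\mathcal{M}_n$ are $$V_i=\rho_T\Big(\prod_{j\ne i}\frac{z-z_j}{z_i-z_j}\Big),\quad i=1,\dots,n,$$ where $z$ denotes the variable function. A linear map $\rho$ from an operator space $X$ to $\mathcal{B}(\mathcal{H})$ is completely contractive if $\rho\otimes I_k:(X\otimes\mathcal{M}_k,\|\cdot\|_k)\to\mathcal{B}(\mathcal{H})\otimes\mathcal{M}_k$ is contractive for every $k\in\mathbb{N}$. *)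

(* Defs.v *)
From HB Require Import structures.
From mathcomp Require Import all_boot all_order all_algebra.
From mathcomp Require Import complex mxtens.
From mathcomp Require Import all_classical all_reals all_analysis.

Set Implicit Arguments.
Unset Strict Implicit.
Unset Printing Implicit Defensive.

Import Order.TTheory GRing.Theory Num.Theory.
Import numFieldNormedType.Exports.

Local Open Scope classical_set_scope.
Local Open Scope ring_scope.
Local Open Scope complex_scope.

(* R[i] gets the topology and norm that every numFieldType K has on K^o. *)
HB.instance Definition _ (R : rcfType) := NormedModule.copy R[i] R[i]^o.
HB.instance Definition _ (R : rcfType) := Pointed.copy R[i] R[i]^o.

Section PlaneDomains.
Variable R : realType.
Implicit Types U G : set R[i].

Definition unit_circle : set R[i] := [set w | `|w| = 1].

(* The image of the unit circle under a map that is holomorphic and injective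
   on an open neighbourhood of the circle. *)
Definition simple_analytic_closed_curve G : Prop :=
  exists (phi : R[i] -> R[i]) (N : set R[i]),
    [/\ open N,
        unit_circle `<=` N,
        forall w, N w -> derivable phi w 1,
        {in N &, injective phi} &
        G = phi @` unit_circle].

Definition boundary U : set R[i] := closure U `\` U°.

(* For bounded U, the complement of U has as many components in the plane as
   in the Riemann sphere, since only one of them is unbounded. *)
Definition finitely_connected U : Prop :=
  finite_set [set connected_component (~` U) w | w in ~` U].

Definition analytic_domain U : Prop :=
  [/\ U !=set0, open U, connected U, bounded_set U & finitely_connected U] /\
  exists (m : nat) (G : 'I_m -> set R[i]),
    [/\ forall j, simple_analytic_closed_curve (G j),
        trivIset [set: 'I_m] G &
        boundary U = \bigcup_j G j].

End PlaneDomains.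

Section OperatorNorm.
Variable R : realType.

Definition l2norm (m : nat) (v : 'cV[R[i]]_m) : R :=
  Num.sqrt (\sum_i Normc.normc (v i 0) ^+ 2).

Definition opnorm (m : nat) (M : 'M[R[i]]_m) : R :=
  sup [set l2norm (M *m v) | v in [set v | l2norm v <= 1]].

End OperatorNorm.

Section OperatorSpaces.
Variable R : realType.

(* Matricial norms on a space X of vectors: an element of X (x) M_k is written
   as a k x k matrix with entries in X. *)
Definition matrix_norms (X : Type) := forall k : nat, 'M[X]_k -> \bar R.

Definition matrices_over (X : Type) (A : set X) (k : nat) : set 'M[X]_k :=
  [set F | forall a b, A (F a b)].

(* rho (x) I_k, with values in M_n (x) M_k realised by Kronecker products. *)
Definition amplification (X : Type) (n : nat) (rho : X -> 'M[R[i]]_n)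
    (k : nat) (F : 'M[X]_k) : 'M[R[i]]_(n * k) :=
  \sum_a \sum_b tensmx (rho (F a b)) (delta_mx a b).

(* The space is the subset A of X. *)
Definition completely_contractive (X : Type) (A : set X)
    (N : matrix_norms X) (n : nat) (rho : X -> 'M[R[i]]_n) : Prop :=
  forall (k : nat) (F : 'M[X]_k), (0 < k)%N -> matrices_over A F ->
    ((opnorm (amplification rho F))%:E <= N k F)%E.

Definition contractive (X : Type) (A : set X) (N : X -> \bar R) (n : nat)
    (rho : X -> 'M[R[i]]_n) : Prop :=
  forall x : X, A x -> ((opnorm (rho x))%:E <= N x)%E.

End OperatorSpaces.

Section Algebra.
Variable R : realType.
Variable Omega : set R[i].
Implicit Types (p q : {poly R[i]}) (f : R[i] -> R[i]).

Definition pole_free q : Prop := forall w, closure Omega w -> q.[w] != 0.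

Definition ratfun p q : R[i] -> R[i] := fun w => p.[w] / q.[w].

Definition sup_norm f : \bar R :=
  ereal_sup [set (Normc.normc (f w))%:E | w in Omega].

(* Elements of the algebra are taken with their continuous extension to the
   closure of Omega; the values of f outside the closure are irrelevant and
   left unconstrained. *)
Definition A_alg : set (R[i] -> R[i]) :=
  [set f : R[i] -> R[i] | {within closure Omega, continuous f} /\
    forall e : R, 0 < e -> exists p q, pole_free q /\
      (sup_norm (f \- ratfun p q)%R <= e%:E)%E].

Definition min_norm : matrix_norms R (R[i] -> R[i]) :=
  fun k F => ereal_sup
    [set (opnorm (map_mx (fun f => f w) F))%:E | w in closure Omega].

Variable n : nat.
Variable T : 'M[R[i]]_n.+1.

Definition ratfun_mx p q : 'M[R[i]]_n.+1 :=
  horner_mx T p *m invmx (horner_mx T q).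

(* M is the limit of r(T) as the rational function r, with poles off the
   closure of Omega, tends to f uniformly on Omega. *)
Definition is_calculus f (M : 'M[R[i]]_n.+1) : Prop :=
  forall e : R, 0 < e -> exists2 d : R, 0 < d &
    forall p q, pole_free q ->
      (sup_norm (f \- ratfun p q)%R <= d%:E)%E ->
      opnorm (ratfun_mx p q - M) <= e.

(* f(T); the default value 0 only serves when no such limit exists. *)
Definition rho_T f : 'M[R[i]]_n.+1 := xget 0 [set M | is_calculus f M].

End Algebra.

Section Interpolation.
Variable R : realType.
Variable Omega : set R[i].
Variable n : nat.
Variable z : 'I_n.+1 -> R[i].

(* C^n is the space of row vectors, so C^n (x) M_k consists of k x k matrices
   of row vectors; the i-th coordinate of the tuple (F(z_1), .., F(z_n)) is the
   matrix of the i-th coordinates of the entries. *)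
Definition eval_tuple (k : nat) (F : 'M[R[i] -> R[i]]_k) :
    'M['rV[R[i]]_n.+1]_k :=
  map_mx (fun f => \row_i f (z i)) F.

Definition interp_ball (k : nat) : set 'M['rV[R[i]]_n.+1]_k :=
  [set W | exists F : 'M[R[i] -> R[i]]_k,
    [/\ matrices_over (A_alg Omega) F, (min_norm Omega F <= 1)%E &
        W = eval_tuple F]].
Arguments interp_ball : clear implicits.

(* The norm with the given unit ball is its Minkowski functional. *)
Definition HC_norm : matrix_norms R 'rV[R[i]]_n.+1 :=
  fun k W => ereal_inf [set t%:E | t in [set t : R | 0 < t /\
    interp_ball k (map_mx (fun w => (t^-1)%:C *: w) W)]].

(* The norm on C^n itself: the case k = 1, with M_1 identified with C. *)
Definition HC_norm1 (w : 'rV[R[i]]_n.+1) : \bar R :=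
  HC_norm (const_mx w : 'M['rV[R[i]]_n.+1]_1).

Variable T : 'M[R[i]]_n.+1.

Definition V (i : 'I_n.+1) : 'M[R[i]]_n.+1 :=
  rho_T Omega T (fun w => \prod_(j | j != i) ((w - z j) / (z i - z j))).

Definition L_T (w : 'rV[R[i]]_n.+1) : 'M[R[i]]_n.+1 :=
  \sum_i w 0 i *: V i.

End Interpolation.

(* Main.v *)
Require Import Defs.
From HB Require Import structures.
From mathcomp Require Import all_boot all_order all_algebra.
From mathcomp Require Import complex mxtens.
From mathcomp Require Import all_classical all_reals all_analysis.

(** Both equivalences express one fact: [L_T] is the map induced by [rho_T] on
    the quotient of the algebra by the functions vanishing at the nodes [z i].

    The eigenvalues are as many as the dimension, so they are all the roots of
    the characteristic polynomial, and by Cayley-Hamilton a polynomial in [T]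
    depends only on its values at them ([horner_mx_eq]). The same then holds
    for rational functions ([ratfun_mx_lagrange]), with a linear dependence on
    the values, hence for their uniform limits: [f(T)] is the combination of
    the Lagrange matrices [V i] with coefficients [f (z i)]. In other words
    [rho_T] is [L_T] after evaluation at the nodes ([rho_T_eval]), and likewise
    for the amplifications ([amplification_rho_T]).

    On the other side, the ball of [HC_norm] is by definition the image under
    evaluation of the unit ball of [min_norm], so [HC_norm] is the quotient
    norm, and a homogeneous functional is bounded by [HC_norm] if and only if
    its pullback along evaluation is bounded by [min_norm] ([le_HC_normP]).
    Applied to the operator norm of each amplification this is the statement
    on complete contractivity. Applied at [k = 1] to the operator norm of
    [L_T] it is the statement on contractivity, once the sup norm over the
    domain is identified with the one over its closure ([min_norm11]). *)

Import Order.TTheory GRing.Theory Num.Theory.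
Import numFieldNormedType.Exports.

Local Open Scope classical_set_scope.
Local Open Scope ring_scope.

Set Implicit Arguments.
Unset Strict Implicit.

(** * Norms of complex matrices *)

Lemma const_mx11 (X : Type) (M : 'M[X]_1) : const_mx (M 0 0) = M.
Proof. by apply/matrixP => a b; rewrite !ord1 mxE. Qed.

Lemma normc_ge0 (R : rcfType) (c : R[i]) : 0 <= Normc.normc c.
Proof. by rewrite -lecR; exact: (normr_ge0 c). Qed.

Lemma normc_sum (R : rcfType) (I : finType) (F : I -> R[i]) :
  Normc.normc (\sum_i F i) <= \sum_i Normc.normc (F i).
Proof.
elim/big_ind2: _ => [|a b c d ab cd|//]; first by rewrite Normc.normc0.
exact: le_trans (le_normcD _ _) (lerD ab cd).
Qed.

Lemma normc_real (R : rcfType) (t : R) :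
  0 <= t -> Normc.normc t%:C%C = t.
Proof. by move=> t0; rewrite /= expr0n addr0 sqrtr_sqr ger0_norm. Qed.

Section OperatorNormTheory.
Variable R : realType.

Lemma normc_le_l2norm m (v : 'cV[R[i]]_m) i : Normc.normc (v i 0) <= l2norm v.
Proof.
rewrite /l2norm -[leLHS]ger0_norm ?normc_ge0// -sqrtr_sqr.
apply: ler_wsqrtr; rewrite (bigD1 i)//= lerDl.
by apply: sumr_ge0 => j _; exact: sqr_ge0.
Qed.

Lemma l2norm_le_sum m (v : 'cV[R[i]]_m) :
  l2norm v <= \sum_i Normc.normc (v i 0).
Proof.
have S0 : 0 <= \sum_i Normc.normc (v i 0).
  by apply: sumr_ge0 => i _; exact: normc_ge0.
rewrite /l2norm -[leRHS]ger0_norm// -sqrtr_sqr.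
apply: ler_wsqrtr; rewrite expr2 mulr_suml; apply: ler_sum => i _.
rewrite expr2 ler_wpM2l ?normc_ge0// (bigD1 i)//= lerDl.
by apply: sumr_ge0 => j _; exact: normc_ge0.
Qed.

Lemma l2norm0 m : l2norm (0 : 'cV[R[i]]_m) = 0.
Proof.
by rewrite /l2norm big1 ?sqrtr0// => i _; rewrite mxE Normc.normc0 expr0n.
Qed.

Lemma l2normZ m (c : R[i]) (v : 'cV[R[i]]_m) :
  l2norm (c *: v) = Normc.normc c * l2norm v.
Proof.
rewrite /l2norm -[Normc.normc c]ger0_norm ?normc_ge0// -sqrtr_sqr.
rewrite -sqrtrM ?sqr_ge0// mulr_sumr; congr Num.sqrt; apply: eq_bigr => i _.
by rewrite mxE Normc.normcM exprMn.
Qed.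

(** A crude bound: it makes the supremum defining [opnorm] finite, and shows
    that entrywise small matrices have small norm. *)
Lemma l2norm_mulmx_le m (M : 'M[R[i]]_m) (v : 'cV[R[i]]_m) : l2norm v <= 1 ->
  l2norm (M *m v) <= \sum_i \sum_j Normc.normc (M i j).
Proof.
move=> v1; apply: (le_trans (l2norm_le_sum _)); apply: ler_sum => i _.
rewrite mxE; apply: (le_trans (normc_sum _)); apply: ler_sum => j _.
rewrite Normc.normcM ler_piMr ?normc_ge0//.
exact: le_trans (normc_le_l2norm _ _) v1.
Qed.

Lemma opnorm_le m (M : 'M[R[i]]_m) (t : R) :
  (forall v, l2norm v <= 1 -> l2norm (M *m v) <= t) -> opnorm M <= t.
Proof.
move=> Mt; apply: ge_sup => [|_ [v v1 <-]]; last exact: Mt.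
by exists (l2norm (M *m 0)), 0 => //=; rewrite l2norm0 ler01.
Qed.

Lemma le_opnorm m (M : 'M[R[i]]_m) (v : 'cV[R[i]]_m) :
  l2norm v <= 1 -> l2norm (M *m v) <= opnorm M.
Proof.
move=> v1; apply: ub_le_sup; last by exists v.
exists (\sum_i \sum_j Normc.normc (M i j)) => _ [u u1 <-].
exact: l2norm_mulmx_le.
Qed.

Lemma opnorm_ge0 m (M : 'M[R[i]]_m) : 0 <= opnorm M.
Proof.
have := @le_opnorm m M 0; rewrite mulmx0 l2norm0; apply.
exact: ler01.
Qed.

Lemma opnorm_le_sum m (M : 'M[R[i]]_m) :
  opnorm M <= \sum_i \sum_j Normc.normc (M i j).
Proof. by apply: opnorm_le => v; exact: l2norm_mulmx_le. Qed.

(** The entry is a coordinate of the image of a unit basis vector. *)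
Lemma normc_le_opnorm m (M : 'M[R[i]]_m) i j : Normc.normc (M i j) <= opnorm M.
Proof.
have -> : M i j = (M *m delta_mx j (0 : 'I_1)) i 0 by rewrite -colE mxE.
apply: (le_trans (normc_le_l2norm _ _)); apply: le_opnorm.
apply: (le_trans (l2norm_le_sum _)); rewrite (bigD1 j)//= big1 ?addr0.
  by rewrite mxE !eqxx Normc.normc1.
by move=> k /negPf kj; rewrite mxE kj Normc.normc0.
Qed.

Lemma opnormZ m (t : R) (M : 'M[R[i]]_m) : 0 < t ->
  opnorm (t%:C%C *: M) = t * opnorm M.
Proof.
have le_opnormZ (s : R) (N : 'M[R[i]]_m) : 0 < s ->
    opnorm (s%:C%C *: N) <= s * opnorm N.
  move=> s0; apply: opnorm_le => v v1; rewrite -scalemxAl l2normZ.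
  by rewrite (normc_real (ltW s0)) ler_pM2l// le_opnorm.
move=> t0; apply/le_anti; rewrite le_opnormZ//= mulrC -ler_pdivlMr//.
have := le_opnormZ t^-1 (t%:C%C *: M); rewrite invr_gt0 => /(_ t0).
by rewrite scalerA -rmorphM mulVf ?gt_eqF// rmorph1 scale1r mulrC.
Qed.

Lemma opnorm_mx11 (M : 'M[R[i]]_1) : opnorm M = Normc.normc (M 0 0).
Proof.
apply/le_anti; rewrite normc_le_opnorm andbT.
by apply: (le_trans (opnorm_le_sum _)); rewrite !big_ord1.
Qed.

End OperatorNormTheory.

(** * Continuity of complex functions *)

Lemma continuous_horner_num (K : numFieldType) (p : {poly K}) :
  continuous (fun w : K => p.[w]).
Proof.
elim/poly_ind: p => [|p c IHp].
  by under eq_fun do rewrite horner0; exact: cst_continuous.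
under eq_fun do rewrite hornerMXaddC.
by move=> w; apply: (cvgD (cvgM (IHp w) (@cvg_id _ (nbhs w))) (cvg_cst c)).
Qed.

Lemma within_continuousZ (K : numFieldType) (A : set K) (c : K) (f : K -> K) :
  {within A, continuous f} -> {within A, continuous (fun w => c * f w)}.
Proof. by move=> fA w; exact: (cvgM (cvg_cst c) (fA w)). Qed.

Lemma within_closure_approx (K : numFieldType) (A : set K) (f : K -> K)
    (w e : K) :
  {within closure A, continuous f} -> closure A w -> 0 < e ->
  exists2 y, A y & `|f w - f y| < e.
Proof.
move=> /subspace_continuousP f_cont Aw e0.
have /cvgrPdist_lt/(_ _ e0) := f_cont w Aw.
rewrite near_withinE => /Aw [y [Ay fwy]]; exists y => //.
exact/fwy/subset_closure.
Qed.

(** * The function algebra and its norms *)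

Section FunctionAlgebra.
Variables (R : realType) (Omega : set R[i]).
Implicit Type f : R[i] -> R[i].

Lemma sup_norm_leP f (e : R) : (sup_norm Omega f <= e%:E)%E <->
  forall w, Omega w -> Normc.normc (f w) <= e.
Proof.
split=> [fe w Ow|fe].
  rewrite -lee_fin; apply: le_trans fe; apply: ereal_sup_ubound.
  by exists w.
by apply: ge_ereal_sup => _ [w Ow <-]; rewrite lee_fin; exact: fe.
Qed.

Lemma A_alg_poly (p : {poly R[i]}) : A_alg Omega (fun w => p.[w]).
Proof.
split.
  apply: continuous_subspaceT; exact: (@continuous_horner_num R[i] p).
move=> e e0; exists p, 1; split=> [w _|]; first by rewrite hornerC oner_neq0.
apply/sup_norm_leP => w _.
by rewrite /ratfun /= hornerC divr1 subrr Normc.normc0 ltW.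
Qed.

Lemma A_algZ (c : R[i]) f :
  A_alg Omega f -> A_alg Omega (fun w => c * f w).
Proof.
move=> [f_cont f_approx]; split.
  exact: (@within_continuousZ R[i]).
move=> e e0; have c0 : 0 < Normc.normc c + 1 by rewrite ltr_wpDl ?normc_ge0.
have [|p [q [qO pq]]] := f_approx (e / (Normc.normc c + 1)).
  exact: divr_gt0.
exists (c *: p), q; split=> //; apply/sup_norm_leP => w Ow.
rewrite /ratfun /= hornerZ -mulrA -mulrBr Normc.normcM.
move/sup_norm_leP: pq => /(_ w Ow); rewrite /ratfun /= => fpq.
apply: (@le_trans _ _ (Normc.normc c * (e / (Normc.normc c + 1)))).
  by rewrite ler_wpM2l ?normc_ge0.
by rewrite mulrCA ler_piMr ?(ltW e0)// ler_pdivrMr// mul1r lerDl.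
Qed.

(** By continuity each value on the closure is a limit of values on the set,
    so the norm on the algebra may be read off on either. *)
Lemma normc_le_sup_norm f w : {within closure Omega, continuous f} ->
  closure Omega w -> ((Normc.normc (f w))%:E <= sup_norm Omega f)%E.
Proof.
move=> f_cont Ow; apply/lee_addgt0Pr => e e0.
have [|y Oy fwy] := @within_closure_approx R[i] _ _ _ e%:C%C f_cont Ow.
  by rewrite ltcR.
have {}fwy : Normc.normc (f w - f y) < e by rewrite -ltcR.
apply: (@le_trans _ _ ((Normc.normc (f y))%:E + e%:E)%E).
  rewrite -EFinD lee_fin -[f w](subrK (f y)) [leRHS]addrC.
  exact: le_trans (le_normcD _ _) (lerD (ltW fwy) (lexx _)).
by rewrite leeD2r//; apply: ereal_sup_ubound; exists y.
Qed.

Lemma min_norm11 f : {within closure Omega, continuous f} ->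
  min_norm Omega (const_mx f : 'M[R[i] -> R[i]]_1) = sup_norm Omega f.
Proof.
move=> f_cont; apply/le_anti/andP; split.
  apply: ge_ereal_sup => _ [w Ow <-].
  by rewrite opnorm_mx11 !mxE; exact: normc_le_sup_norm.
apply: ge_ereal_sup => _ [w Ow <-]; apply: ereal_sup_ubound; exists w.
  exact: subset_closure.
by rewrite opnorm_mx11 !mxE.
Qed.

Lemma min_norm_ge0 k (F : 'M[R[i] -> R[i]]_k) :
  Omega !=set0 -> (0 <= min_norm Omega F)%E.
Proof.
move=> [w Ow]; apply: (@le_trans _ _ (opnorm (map_mx (fun f => f w) F))%:E).
  by rewrite lee_fin opnorm_ge0.
by apply: ereal_sup_ubound; exists w => //; exact: subset_closure.
Qed.

Lemma min_norm_scale_le1 k (F : 'M[R[i] -> R[i]]_k) (t : R) : 0 < t ->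
  (min_norm Omega F <= t%:E)%E ->
  (min_norm Omega (map_mx (fun f w => t^-1%:C%C * f w)%R F) <= 1)%E.
Proof.
move=> t0 Ft; apply: ge_ereal_sup => _ [w Ow <-].
have -> : map_mx (fun f => f w) (map_mx (fun f w => t^-1%:C%C * f w) F) =
    t^-1%:C%C *: map_mx (fun f => f w) F by apply/matrixP => a b; rewrite !mxE.
rewrite opnormZ ?invr_gt0// lee_fin mulrC ler_pdivrMr// mul1r -lee_fin.
by apply: le_trans Ft; apply: ereal_sup_ubound; exists w.
Qed.

End FunctionAlgebra.

(** * The functional calculus of a matrix with simple spectrum *)

Section SimpleSpectrum.
Variables (R : realType) (Omega : set R[i]) (n : nat).
Variables (T : 'M[R[i]]_n.+1) (z : 'I_n.+1 -> R[i]).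
Hypothesis z_inj : injective z.

Definition lagrange i : {poly R[i]} :=
  \prod_(j | j != i) ((z i - z j)^-1 *: ('X - (z j)%:P)).

Lemma horner_lagrange i w :
  (lagrange i).[w] = \prod_(j | j != i) ((w - z j) / (z i - z j)).
Proof.
rewrite horner_prod; apply: eq_bigr => j _.
by rewrite hornerZ hornerXsubC mulrC.
Qed.

Lemma lagrange_node i k : (lagrange i).[z k] = (k == i)%:R.
Proof.
rewrite horner_lagrange; have [->|ki] := eqVneq k i.
  by rewrite big1// => j ji; rewrite divff// subr_eq0 inj_eq// eq_sym.
by rewrite (bigD1 k)//= subrr mul0r mul0r.
Qed.

Hypothesis z_eigen : forall i, eigenvalue T (z i).

(** Distinct eigenvalues filling up the dimension are all the roots of the
    characteristic polynomial, so a polynomial vanishing at them annihilates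
    [T] by Cayley-Hamilton. *)
Lemma horner_mx_eq (p q : {poly R[i]}) :
  (forall i, p.[z i] = q.[z i]) -> horner_mx T p = horner_mx T q.
Proof.
move=> pq; set rs := [seq z i | i <- enum 'I_n.+1].
have rs_uniq : uniq_roots rs.
  by rewrite uniq_rootsE map_inj_uniq// enum_uniq.
have charE : char_poly T = \prod_(a <- rs) ('X - a%:P).
  rewrite [LHS](@all_roots_prod_XsubC _ _ rs)//.
  - by rewrite (monicP (char_poly_monic T)) scale1r.
  - by rewrite size_char_poly size_map size_enum_ord.
  - by apply/allP => _ /mapP[i _ ->]; rewrite -eigenvalue_root_char.
apply/eqP; rewrite -subr_eq0 -rmorphB.
have [|r ->] := @uniq_roots_prod_XsubC _ (p - q) rs _ rs_uniq.
  apply/allP => _ /mapP[i _ ->].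
  by rewrite rootE hornerD hornerN pq subrr.
by rewrite -charE rmorphM /= Cayley_Hamilton mulr0.
Qed.

Lemma horner_mx_lagrange (p : {poly R[i]}) :
  horner_mx T p = \sum_i p.[z i] *: horner_mx T (lagrange i).
Proof.
rewrite (@horner_mx_eq p (\sum_i p.[z i] *: lagrange i)).
  by rewrite raddf_sum; apply: eq_bigr => i _; rewrite /= horner_mxZ.
move=> k; rewrite horner_sum (bigD1 k)//= big1 => [|i ik].
  by rewrite hornerZ lagrange_node eqxx mulr1 addr0.
by rewrite hornerZ lagrange_node eq_sym (negPf ik) mulr0.
Qed.

(** The inverse of [q(T)] is [s(T)] for the polynomial [s] interpolating
    [1 / q] at the eigenvalues. *)
Lemma ratfun_mx_lagrange (p q : {poly R[i]}) :
  (forall i, q.[z i] != 0) ->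
  ratfun_mx T p q = \sum_i ratfun p q (z i) *: horner_mx T (lagrange i).
Proof.
move=> q0; pose s := \sum_i (q.[z i])^-1 *: lagrange i.
have sE k : s.[z k] = (q.[z k])^-1.
  rewrite horner_sum (bigD1 k)//= big1 => [|i ik].
    by rewrite hornerZ lagrange_node eqxx mulr1 addr0.
  by rewrite hornerZ lagrange_node eq_sym (negPf ik) mulr0.
have qs1 : horner_mx T q *m horner_mx T s = 1%:M.
  rewrite -[LHS]rmorphM -[RHS](rmorph1 (horner_mx T)); apply: horner_mx_eq => i.
  by rewrite hornerM sE mulfV// hornerC.
rewrite /ratfun_mx (_ : invmx _ = horner_mx T s); last first.
  have [qU _] := mulmx1_unit qs1.
  by rewrite -[LHS]mulmx1 -qs1 mulmxA mulVmx// mul1mx.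
rewrite -[LHS]rmorphM /= horner_mx_lagrange; apply: eq_bigr => i _.
by rewrite hornerM sE.
Qed.

Hypothesis z_Omega : forall i, Omega (z i).

(** [ratfun_mx T p q] depends linearly on the values of [p / q] at the
    eigenvalues, and these are close to the values of [f] when [p / q] is
    uniformly close to [f]; the constant [C] is the modulus of this linear
    dependence. *)
Lemma is_calculus_lagrange (f : R[i] -> R[i]) :
  is_calculus Omega T f (\sum_i f (z i) *: horner_mx T (lagrange i)).
Proof.
have [C CE] : exists C, C =
    \sum_a \sum_b \sum_i Normc.normc (horner_mx T (lagrange i) a b).
  by eexists.
have C0 : 0 <= C by rewrite CE; do 3!apply: sumr_ge0 => ? _; exact: normc_ge0.
move=> e e0; have C1 : 0 < C + 1 by rewrite ltr_wpDl.
exists (e / (C + 1)); first exact: divr_gt0.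
move=> p q q0 /sup_norm_leP fpq; rewrite ratfun_mx_lagrange; last first.
  by move=> i; apply: q0; exact: subset_closure.
rewrite -sumrB; apply: (le_trans (opnorm_le_sum _)).
apply: (@le_trans _ _ (e / (C + 1) * C)); last first.
  by rewrite -mulrA ler_piMr ?(ltW e0)// mulrC ler_pdivrMr// mul1r lerDl.
rewrite [X in _ * X]CE mulr_sumr; apply: ler_sum => a _.
rewrite mulr_sumr; apply: ler_sum => b _.
rewrite mulr_sumr summxE; apply: (le_trans (normc_sum _)).
apply: ler_sum => i _.
rewrite -scalerBl mxE Normc.normcM ler_wpM2r ?normc_ge0//.
by rewrite -(normcN (_ - _ : R[i])) opprB; exact: (fpq _ (z_Omega i)).
Qed.

(** A rational function close enough to [f] for both limits is within [e / 2]
    of each; the density of such functions near [f] is what makes the limit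
    unique. *)
Lemma is_calculus_unique (f : R[i] -> R[i]) (M N : 'M[R[i]]_n.+1) :
  A_alg Omega f -> is_calculus Omega T f M -> is_calculus Omega T f N -> M = N.
Proof.
move=> [_ f_approx] fM fN; apply/matrixP => a b; apply/eqP.
rewrite -subr_eq0; apply/eqP/Normc.eq0_normc/le_anti.
rewrite normc_ge0 andbT; apply/ler_addgt0Pr => e e0; rewrite add0r.
have e20 : 0 < e / 2 by rewrite divr_gt0.
have [d1 d10 fMd] := fM _ e20; have [d2 d20 fNd] := fN _ e20.
have [|p [q [q0 pq]]] := f_approx (Num.min d1 d2); first by rewrite lt_min d10.
have pq1 : (sup_norm Omega (f \- ratfun p q)%R <= d1%:E)%E.
  by apply: le_trans pq _; rewrite lee_fin ge_min lexx.
have pq2 : (sup_norm Omega (f \- ratfun p q)%R <= d2%:E)%E.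
  by apply: le_trans pq _; rewrite lee_fin ge_min lexx orbT.
have Ma := le_trans (normc_le_opnorm _ a b) (fMd _ _ q0 pq1).
have Na := le_trans (normc_le_opnorm _ a b) (fNd _ _ q0 pq2).
set r := ratfun_mx T p q in Ma Na.
have -> : M a b - N a b = (r - N) a b - (r - M) a b.
  by rewrite !mxE opprB [RHS]addrC addrA subrK.
rewrite (splitr e); apply: le_trans (le_normcD _ _) _; rewrite normcN.
exact: lerD.
Qed.

Lemma rho_T_lagrange (f : R[i] -> R[i]) : A_alg Omega f ->
  rho_T Omega T f = \sum_i f (z i) *: horner_mx T (lagrange i).
Proof.
move=> fA; apply: xget_unique => [|M fM]; first exact: is_calculus_lagrange.
exact: is_calculus_unique fM (is_calculus_lagrange f).
Qed.

(** The Lagrange polynomials belong to the algebra, so for them the limit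
    procedure gives back the polynomial calculus. *)
Lemma V_lagrange i : V Omega z T i = horner_mx T (lagrange i).
Proof.
rewrite /V (_ : (fun _ => _) = fun w => (lagrange i).[w]); last first.
  by apply/funext => w; rewrite horner_lagrange.
by rewrite rho_T_lagrange ?[RHS]horner_mx_lagrange//; exact: A_alg_poly.
Qed.

Lemma rho_T_eval (f : R[i] -> R[i]) : A_alg Omega f ->
  rho_T Omega T f = L_T Omega z T (\row_i f (z i)).
Proof.
move=> fA; rewrite rho_T_lagrange//; apply: eq_bigr => i _.
by rewrite mxE V_lagrange.
Qed.

End SimpleSpectrum.

(** * Maps out of the interpolation norm *)

Section InterpolationNorm.
Variables (R : realType) (Omega : set R[i]) (n : nat).
Variable z : 'I_n.+1 -> R[i].
Hypothesis Omega_neq0 : Omega !=set0.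

(** [HC_norm] is the quotient norm of [min_norm] along evaluation at the
    nodes: its unit ball is the image of the unit ball. A homogeneous
    functional on the quotient is thus bounded by the quotient norm exactly
    when its pullback is bounded by the norm upstairs. *)
Lemma le_HC_normP k (Phi : 'M['rV[R[i]]_n.+1]_k -> R) :
  (forall (t : R) W, 0 < t ->
     Phi (map_mx (fun w => t%:C%C *: w) W) = t * Phi W) ->
  (forall F, matrices_over (A_alg Omega) F ->
     ((Phi (eval_tuple z F))%:E <= min_norm Omega F)%E) <->
  (forall W, ((Phi W)%:E <= HC_norm Omega z W)%E).
Proof.
move=> PhiZ; split=> [Phi_min W|Phi_HC F FA].
  apply: le_ereal_inf_tmp => _ [t [t0 [F [FA F1 WF]]] <-].
  have := le_trans (Phi_min F FA) F1.
  by rewrite -WF PhiZ ?invr_gt0// !lee_fin mulrC ler_pdivrMr// mul1r.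
have := min_norm_ge0 F Omega_neq0.
case Fs : (min_norm Omega F) => [s| |] // s0; last exact: leey.
(* The norm s may be 0, so F is scaled by s + e instead. *)
apply/lee_addgt0Pr => e e0; have t0 : 0 < s + e by rewrite ltr_wpDl.
apply: le_trans (Phi_HC _) _; apply: ereal_inf_lbound.
exists (s + e) => //; split=> //.
exists (map_mx (fun f w => (s + e)^-1%:C%C * f w) F); split.
- by move=> a b; rewrite mxE; exact/A_algZ/FA.
- by apply: min_norm_scale_le1 => //; rewrite Fs lee_fin lerDl ltW.
- by apply/matrixP => a b; apply/rowP => i; rewrite !mxE.
Qed.

End InterpolationNorm.

Section Amplification.
Variables (R : realType) (Omega : set R[i]) (n : nat).
Variables (T : 'M[R[i]]_n.+1) (z : 'I_n.+1 -> R[i]).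

Lemma L_TZ (c : R[i]) (w : 'rV[R[i]]_n.+1) :
  L_T Omega z T (c *: w) = c *: L_T Omega z T w.
Proof.
by rewrite /L_T scaler_sumr; apply: eq_bigr => i _; rewrite mxE scalerA.
Qed.

Lemma amplification_L_TZ k (c : R[i]) (W : 'M['rV[R[i]]_n.+1]_k) :
  amplification (L_T Omega z T) (map_mx (fun w => c *: w) W) =
  c *: amplification (L_T Omega z T) W.
Proof.
rewrite /amplification scaler_sumr; apply: eq_bigr => a _.
rewrite scaler_sumr; apply: eq_bigr => b _; rewrite mxE L_TZ.
by apply/matrixP => i j; rewrite !mxE mulrA.
Qed.

End Amplification.

Lemma amplification_rho_T (R : realType) (Omega : set R[i]) (n : nat)
    (T : 'M[R[i]]_n.+1) (z : 'I_n.+1 -> R[i]) k (F : 'M[R[i] -> R[i]]_k) :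
  injective z -> (forall i, eigenvalue T (z i)) -> (forall i, Omega (z i)) ->
  matrices_over (A_alg Omega) F ->
  amplification (rho_T Omega T) F =
  amplification (L_T Omega z T) (eval_tuple z F).
Proof.
move=> z_inj z_eigen z_Omega FA; apply: eq_bigr => a _; apply: eq_bigr => b _.
by rewrite (rho_T_eval z_inj)// mxE.
Qed.

Unset Implicit Arguments.
Set Strict Implicit.

Theorem theorem10 (R : realType) (Omega : set R[i]) (n : nat)
    (T : 'M[R[i]]_n.+1) (z : 'I_n.+1 -> R[i]) :
  analytic_domain Omega ->
  injective z ->
  (forall i, Omega (z i)) ->
  (forall i, eigenvalue T (z i)) ->
  let rho_contractive :=
    contractive (A_alg Omega) (sup_norm Omega) (rho_T Omega T) in
  let L_contractive :=
    contractive [set: 'rV[R[i]]_n.+1] (HC_norm1 Omega z) (L_T Omega z T) in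
  (rho_contractive <-> L_contractive) /\
  (rho_contractive ->
    (completely_contractive (A_alg Omega) (min_norm Omega) (rho_T Omega T) <->
     completely_contractive [set: 'rV[R[i]]_n.+1] (HC_norm Omega z)
       (L_T Omega z T))).
Proof.
move=> [[domain_neq0 _ _ _ _] _] z_inj z_Omega z_eigen.
move=> rho_contractive L_contractive.
split=> [|_].
  (* The scalar norms are the case k = 1 of the matricial ones. *)
  have HCP := @le_HC_normP R Omega n z domain_neq0 1
    (fun W => opnorm (L_T Omega z T (W 0 0))).
  have [|rhoL Lrho] := HCP.
    by move=> t W t0; rewrite mxE L_TZ opnormZ.
  split=> [rho_c w _ | L_c f fA].
    have := rhoL _ (const_mx w); rewrite mxE; apply=> F FA.
    rewrite -(const_mx11 F) min_norm11; last by case: (FA 0 0).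
    by rewrite !mxE -(rho_T_eval z_inj)//; exact: rho_c.
  have := Lrho _ (const_mx f); rewrite min_norm11; last by case: fA.
  rewrite !mxE -(rho_T_eval z_inj)//; apply=> [W|a b]; last by rewrite mxE.
  by rewrite -[in leRHS](const_mx11 W); exact: L_c.
have HCP k := @le_HC_normP R Omega n z domain_neq0 k
  (fun W => opnorm (amplification (L_T Omega z T) W)).
have {HCP}HCP k := HCP k (fun t W t0 => etrans
  (congr1 (@opnorm R _) (amplification_L_TZ Omega T z t%:C%C W))
  (opnormZ _ t0)).
split=> cc k F k0 FA.
  by apply: (HCP k).1 => G GA; rewrite -amplification_rho_T//; exact: cc.
rewrite (amplification_rho_T z_inj)//.
by apply: (HCP k).2 => // W; exact: cc.
Qed.
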